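(* Let $A$ and $B$ be Leibniz algebras over a field $\mathbb{F}$. Suppose the factor system $(\varphi_1,\varphi_1',f_1)$ of $A$ by $B$ belongs to the extension $0\to A\xrightarrow{\sigma_1}L_1\xrightarrow{\pi_1}B\to0$ and section $T_1:B\to L_1$, and the factor system $(\varphi_2,\varphi_2',f_2)$ of $A$ by $B$ belongs to the extension $0\to A\xrightarrow{\sigma_2}L_2\xrightarrow{\pi_2}B\to0$ and section $T_2:B\to L_2$. Then the factor systems are equivalent if and only if the extensions are equivalent.
   Context: All algebras are vector spaces over a fixed field $\mathbb{F}$ with a bilinear multiplication (juxtaposition). A Leibniz algebra is an algebra satisfying $x(yz)=(xy)z+y(xz)$ for all $x,y,z$. $\mathcal{L}(A)$ is the space of linear maps $A\to A$, $\mathrm{Der}(A)\subseteq\mathcal{L}(A)$ the space of derivations ($D(mn)=D(m)n+mD(n)$), and $\mathrm{ad}^l_m n=mn$, $\mathrm{ad}^r_m n=nm$. A factor system of $A$ by $B$ is a tuple $(\varphi,\varphi',f)$ with $\varphi:B\to\mathrm{Der}(A)$ linear, $\varphi':B\to\mathcal{L}(A)$ linear, $f:B\times B\to A$ bilinear, such that for all $m,n\in A$, $i,j,k\in B$: (1) $m(\varphi(i)n)=(\varphi'(i)m)n+\varphi(i)(mn)$; (2) $m(\varphi'(i)n)=\varphi'(i)(mn)+n(\varphi'(i)m)$; (3) $\mathrm{ad}^r_{f(i,j)}+\varphi'(ij)=\varphi'(j)\varphi'(i)+\varphi(i)\varphi'(j)$; (4) $\varphi(i)(mn)=(\varphi(i)m)n+m(\varphi(i)n)$;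 (5) $\varphi(i)\varphi(j)=\varphi(ij)+\varphi(j)\varphi(i)+\mathrm{ad}^l_{f(i,j)}$; (6) $\varphi(i)\varphi'(j)=\varphi'(j)\varphi(i)+\varphi'(ij)+\mathrm{ad}^r_{f(i,j)}$; (7) $f(i,jk)+\varphi(i)f(j,k)=f(ij,k)+\varphi'(k)f(i,j)+f(j,ik)+\varphi(j)f(i,k)$. An extension of $A$ by $B$ is a short exact sequence $0\to A\xrightarrow{\sigma}L\xrightarrow{\pi}B\to0$ with $L$ a Leibniz algebra and $\sigma,\pi$ algebra homomorphisms. A section is a linear map $T:B\to L$ with $\pi T=I_B$. For $x\in L$, $m\in A$ put $P(x)m=\sigma^{-1}(x\sigma(m))$ and $P'(x)m=\sigma^{-1}(\sigma(m)x)$. A factor system $(\varphi,\varphi',f)$ belongs to the extension and $T$ if $\varphi=PT$, $\varphi'=P'T$, and $\sigma(f(i,j))=T(i)T(j)-T(ij)$ for all $i,j\in B$. Two extensions $0\to A\xrightarrow{\sigma_1}L_1\xrightarrow{\pi_1}B\to0$ and $0\to A\xrightarrow{\sigma_2}L_2\xrightarrow{\pi_2}B\to0$ are equivalent if there is an algebra isomorphism $\tau:L_1\to L_2$ with $\tau\sigma_1=\sigma_2$ and $\pi_2\tau=\pi_1$. Factor systems $(\varphi,\varphi',f)$ and $(\psi,\psi',g)$ of $A$ by $B$ are equivalent if there is a linear map $E:B\to A$ (called an equivalence) such that for all $i,j\in B$: $\psi(i)=\varphi(i)+\mathrm{ad}^l_{E(i)}$; $\psi'(i)=\varphi'(i)+\mathrm{ad}^r_{E(i)}$;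 $g(i,j)=f(i,j)+\varphi'(j)E(i)+\varphi(i)E(j)+E(i)E(j)-E(ij)$. *)

(* Defs.v *)
From HB Require Import structures.
From mathcomp Require Import all_boot all_order all_algebra.
From mathcomp Require Import sesquilinear.

Set Implicit Arguments.
Unset Strict Implicit.
Unset Printing Implicit Defensive.

Import GRing.Theory.
Local Open Scope ring_scope.

Declare Scope nalg_scope.
Delimit Scope nalg_scope with nalg.
Reserved Notation "x ** y" (at level 40, left associativity).

(* Algebras are neither associative nor unital nor finite-dimensional, hence
   are not instances of algType or falgType. *)
HB.mixin Record Lmodule_isNAlg (F : fieldType) A of GRing.Lmodule F A := {
  nmul : A -> A -> A;
  nmul_linearl : forall y, linear (nmul^~ y);
  nmul_linearr : forall x, linear (nmul x)
}.

#[short(type="nalgType")]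
HB.structure Definition NAlg (F : fieldType) :=
  { A of Lmodule_isNAlg F A & GRing.Lmodule F A }.

Notation "x ** y" := (nmul x y) : nalg_scope.
Local Open Scope nalg_scope.

Fact nmul_is_bilinear (F : fieldType) (A : nalgType F) :
  bilinear_for *:%R *:%R (@nmul F A).
Proof. by split=> z; [apply: nmul_linearl | apply: nmul_linearr]. Qed.

HB.instance Definition _ (F : fieldType) (A : nalgType F) :=
  bilinear_isBilinear.Build F A A A *:%R *:%R (@nmul F A) (@nmul_is_bilinear F A).

HB.mixin Record NAlg_isLeibniz (F : fieldType) A of NAlg F A := {
  leibniz_identity :
    forall x y z : A, x ** (y ** z) = (x ** y) ** z + y ** (x ** z)
}.

#[short(type="leibnizType")]
HB.structure Definition Leibniz (F : fieldType) :=
  { A of NAlg_isLeibniz F A & NAlg F A }.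

Definition adl (F : fieldType) (A : nalgType F) (m : A) : A -> A :=
  fun n => m ** n.
Definition adr (F : fieldType) (A : nalgType F) (m : A) : A -> A :=
  fun n => n ** m.

Definition derivation (F : fieldType) (A : nalgType F) (D : {linear A -> A}) :=
  forall m n : A, D (m ** n) = D m ** n + m ** D n.

Definition nmorphism (F : fieldType) (A A' : nalgType F)
  (h : {linear A -> A'}) := {morph h : x y / x ** y}.

(* The space of linear maps A -> A has no module instance here: linearity of
   [u : B -> {linear A -> A}] is expressed pointwise. *)
Definition op_linear (F : fieldType) (A B : lmodType F)
    (u : B -> {linear A -> A}) :=
  forall (c : F) (i j : B) (m : A), u (c *: i + j) m = c *: u i m + u j m.

Record factor_system (F : fieldType) (A B : nalgType F) := FactorSystem {
  fs_phi : B -> {linear A -> A};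
  fs_phi' : B -> {linear A -> A};
  fs_f : {bilinear B -> B -> A};
  fs_phi_linear : op_linear fs_phi;
  fs_phi_der : forall i, derivation (fs_phi i);
  fs_phi'_linear : op_linear fs_phi';
  fs1 : forall (i : B) (m n : A),
    m ** fs_phi i n = fs_phi' i m ** n + fs_phi i (m ** n);
  fs2 : forall (i : B) (m n : A),
    m ** fs_phi' i n = fs_phi' i (m ** n) + n ** fs_phi' i m;
  fs3 : forall i j : B,
    adr (fs_f i j) \+ fs_phi' (i ** j)
      =1 (fs_phi' j \o fs_phi' i) \+ (fs_phi i \o fs_phi' j);
  fs4 : forall (i : B) (m n : A),
    fs_phi i (m ** n) = fs_phi i m ** n + m ** fs_phi i n;
  fs5 : forall i j : B,
    fs_phi i \o fs_phi j
      =1 fs_phi (i ** j) \+ (fs_phi j \o fs_phi i) \+ adl (fs_f i j);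
  fs6 : forall i j : B,
    fs_phi i \o fs_phi' j
      =1 (fs_phi' j \o fs_phi i) \+ fs_phi' (i ** j) \+ adr (fs_f i j);
  fs7 : forall i j k : B,
    fs_f i (j ** k) + fs_phi i (fs_f j k)
      = fs_f (i ** j) k + fs_phi' k (fs_f i j)
        + fs_f j (i ** k) + fs_phi j (fs_f i k)
}.

Record extension (F : fieldType) (A B : nalgType F) := Extension {
  ext_alg : leibnizType F;
  ext_in : {linear A -> ext_alg};
  ext_out : {linear ext_alg -> B};
  ext_in_morph : nmorphism ext_in;
  ext_out_morph : nmorphism ext_out;
  ext_in_inj : injective ext_in;
  ext_exact : forall x : ext_alg, ext_out x = 0 <-> exists a, ext_in a = x;
  ext_out_surj : forall b : B, exists x, ext_out x = b
}.

Record ext_section (F : fieldType) (A B : nalgType F) (e : extension A B) :=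
  ExtSection {
    sec_fun :> {linear B -> ext_alg e};
    sec_funK : cancel sec_fun (ext_out e)
  }.

Section ExtensionAction.
Variables (F : fieldType) (A B : nalgType F) (e : extension A B).
Implicit Types (x : ext_alg e) (m : A).

Fact ext_mull_im x m : exists a, ext_in e a == x ** ext_in e m.
Proof.
have /(ext_exact (x ** ext_in e m)) [a <-] : ext_out e (x ** ext_in e m) = 0.
  by rewrite ext_out_morph ((ext_exact (ext_in e m)).2 (ex_intro _ m erefl)) linear0r.
by exists a.
Qed.

Fact ext_mulr_im x m : exists a, ext_in e a == ext_in e m ** x.
Proof.
have /(ext_exact (ext_in e m ** x)) [a <-] : ext_out e (ext_in e m ** x) = 0.
  by rewrite ext_out_morph ((ext_exact (ext_in e m)).2 (ex_intro _ m erefl)) linear0l.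
by exists a.
Qed.

(* P(x)m = sigma^-1 (x sigma(m)) and P'(x)m = sigma^-1 (sigma(m) x): the image
   of sigma is the kernel of pi, hence a two-sided ideal, so the preimage
   exists; it is unique since sigma is injective. *)
Definition extP x m : A := xchoose (ext_mull_im x m).
Definition extP' x m : A := xchoose (ext_mulr_im x m).

Fact extPE x m : ext_in e (extP x m) = x ** ext_in e m.
Proof. exact/eqP/(xchooseP (ext_mull_im x m)). Qed.

Fact extP'E x m : ext_in e (extP' x m) = ext_in e m ** x.
Proof. exact/eqP/(xchooseP (ext_mulr_im x m)). Qed.
End ExtensionAction.

Definition belongs (F : fieldType) (A B : nalgType F)
    (s : factor_system A B) (e : extension A B) (T : ext_section e) :=
  [/\ forall i, fs_phi s i =1 extP (T i),
      forall i, fs_phi' s i =1 extP' (T i)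
    & forall i j, ext_in e (fs_f s i j) = T i ** T j - T (i ** j)].

Definition extension_equiv (F : fieldType) (A B : nalgType F)
    (e1 e2 : extension A B) :=
  exists tau : {linear ext_alg e1 -> ext_alg e2},
    [/\ nmorphism tau, bijective tau,
        tau \o ext_in e1 =1 ext_in e2
      & ext_out e2 \o tau =1 ext_out e1].

Definition factor_system_equivalence (F : fieldType) (A B : nalgType F)
    (s t : factor_system A B) (E : {linear B -> A}) :=
  [/\ forall i, fs_phi t i =1 fs_phi s i \+ adl (E i),
      forall i, fs_phi' t i =1 fs_phi' s i \+ adr (E i)
    & forall i j, fs_f t i j
        = fs_f s i j + fs_phi' s j (E i) + fs_phi s i (E j)
          + E i ** E j - E (i ** j)].

Definition factor_system_equiv (F : fieldType) (A B : nalgType F)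
    (s t : factor_system A B) :=
  exists E : {linear B -> A}, factor_system_equivalence s t E.

(* Main.v *)
Require Import Defs.
From HB Require Import structures.
From mathcomp Require Import all_boot all_order all_algebra.
From mathcomp Require Import sesquilinear.

(** Both conditions are equivalent to a third one: [s1] belongs to the second
    extension for some choice of section.

    On the one hand, two sections of the same extension differ by a linear map
    [E : B -> A], and replacing [T] by [T + sigma E] changes the associated
    factor system exactly by the formulas defining the equivalence [E]
    ([belongs_shift]).  So the factor systems equivalent to [s2] are precisely
    those belonging to the second extension and some section.

    On the other hand, a section [T] identifies [L] with [A + B] through
    [sigma a + T i], and the product of [L] in these coordinates is
    a formula in the factor system ([belongs_mul]).  Two extensions sharing
    a factor system are therefore isomorphic by matching coordinates
    ([belongs_common_equiv]); conversely an equivalence of extensions carries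
    [T1] to a section with the same factor system ([belongs_transport]). *)

Set Implicit Arguments.
Unset Strict Implicit.
Unset Printing Implicit Defensive.

Import GRing.Theory.
Local Open Scope ring_scope.
Local Open Scope nalg_scope.

Section Coordinates.
Variables (F : fieldType) (A B : nalgType F) (e : extension A B).
Implicit Types (T : ext_section e) (s : factor_system A B).

Lemma ext_out_in (a : A) : ext_out e (ext_in e a) = 0.
Proof. by apply/ext_exact; exists a. Qed.

(** The kernel property of [sigma] for linear maps.  Exactness only gives
    preimages pointwise; they assemble into a linear map because [sigma] is
    injective. *)
Lemma ext_ker_lift (V : lmodType F) (g : {linear V -> ext_alg e}) :
  (forall v, ext_out e (g v) = 0) ->
  exists h : {linear V -> A}, forall v, ext_in e (h v) = g v.
Proof.
move=> g_ker.
have g_im v : exists a, ext_in e a == g v.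
  by have [a <-] := (ext_exact (g v)).1 (g_ker v); exists a.
pose h v := xchoose (g_im v).
have hE v : ext_in e (h v) = g v by exact/eqP/(xchooseP (g_im v)).
have h_lin : linear h.
  by move=> c u v; apply: (@ext_in_inj _ _ _ e); rewrite linearP !hE linearP.
pose hL := GRing.isLinear.Build F V A *:%R h h_lin.
pose hl : {linear V -> A} := HB.pack h hL.
by exists hl.
Qed.

(** The first coordinate of [x] is [sigma^-1 (x - T (pi x))], since [T] being
    a section puts the difference in the kernel of [pi]. *)
Lemma section_coord T : exists r : {linear ext_alg e -> A},
  forall x, x = ext_in e (r x) + T (ext_out e x).
Proof.
pose g : {linear ext_alg e -> ext_alg e} := idfun \- (T \o ext_out e).
have [x|r rE] := @ext_ker_lift _ g; first by rewrite /= linearB sec_funK subrr.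
by exists r => x; rewrite rE /= subrK.
Qed.

(** The coordinates [a], [i] of [sigma a + T i] are unique: this evaluates on
    such a sum any map defined through the projection of [section_coord]. *)
Lemma section_coord_inj T a b i j :
  ext_in e a + T i = ext_in e b + T j -> a = b /\ i = j.
Proof.
move=> eq_ab; have ij : i = j.
  by have := congr1 (ext_out e) eq_ab; rewrite !linearD !ext_out_in !sec_funK !add0r.
by split=> //; apply: (@ext_in_inj _ _ _ e); move: eq_ab; rewrite ij => /addIr.
Qed.

(** Applying the injective [sigma] removes the chosen preimages from the
    definition of belonging, leaving equations between products in [L]. *)
Lemma belongsP s T :
  belongs s T <->
  [/\ forall i m, ext_in e (fs_phi s i m) = T i ** ext_in e m,
      forall i m, ext_in e (fs_phi' s i m) = ext_in e m ** T i
    & forall i j, ext_in e (fs_f s i j) = T i ** T j - T (i ** j)].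
Proof.
split=> [] [sl sr sf]; split=> // i m.
- by rewrite sl extPE.
- by rewrite sr extP'E.
- by apply: (@ext_in_inj _ _ _ e); rewrite sl extPE.
- by apply: (@ext_in_inj _ _ _ e); rewrite sr extP'E.
Qed.

Lemma belongs_mul s T (sT : belongs s T) a b i j :
  (ext_in e a + T i) ** (ext_in e b + T j) =
  ext_in e (a ** b + fs_phi' s j a + fs_phi s i b + fs_f s i j) + T (i ** j).
Proof.
have [sl sr sf] := (belongsP s T).1 sT.
rewrite !linearD sl sr sf ext_in_morph.
by rewrite linearDl !linearDr /= !addrA subrK.
Qed.

(** Any two sections [T], [T'] differ by some [E]; the bilinear expansion of
    the products of [T = T' + sigma E] produces the correction terms in the
    definition of an equivalence of factor systems. *)
Lemma belongs_shift s t T T' (E : {linear B -> A}) :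
    belongs t T -> (forall i, T i = T' i + ext_in e (E i)) ->
  belongs s T' <-> factor_system_equivalence s t E.
Proof.
move=> /belongsP[tl tr tf] TE; have inI := @ext_in_inj _ _ _ e.
have tlE i m : ext_in e (fs_phi t i m) =
    T' i ** ext_in e m + ext_in e (E i ** m).
  by rewrite tl TE linearDl /= ext_in_morph.
have trE i m : ext_in e (fs_phi' t i m) =
    ext_in e m ** T' i + ext_in e (m ** E i).
  by rewrite tr TE linearDr /= ext_in_morph.
have tfE i j : ext_in e (fs_f t i j) =
    (T' i ** T' j - T' (i ** j)) + ext_in e (E i) ** T' j
    + T' i ** ext_in e (E j) + ext_in e (E i ** E j) - ext_in e (E (i ** j)).
  rewrite tf !TE linearDl !linearDr /= ext_in_morph opprD !addrA; congr (_ - _).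
  by rewrite [LHS](ACl (1*5*3*2*4)).
apply: (iff_trans (belongsP _ _)); split=> [] [sl sr sf].
  split=> [i m | i m | i j]; apply: inI => /=.
  - by rewrite tlE linearD sl.
  - by rewrite trE linearD sr.
  - by rewrite tfE linearB !linearD sf sl sr.
have slE i m : ext_in e (fs_phi s i m) = T' i ** ext_in e m.
  by apply: (addIr (ext_in e (E i ** m))); rewrite -tlE sl /= linearD.
have srE i m : ext_in e (fs_phi' s i m) = ext_in e m ** T' i.
  by apply: (addIr (ext_in e (m ** E i))); rewrite -trE sr /= linearD.
split=> // i j; have := tfE i j.
by rewrite sf linearB !linearD slE srE => /addIr/addIr/addIr/addIr.
Qed.

Lemma belongs_shift_equiv s t T (tT : belongs t T) :
  factor_system_equiv s t <-> exists T', belongs s T'.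
Proof.
split=> [[E st] | [T' sT']].
  pose g : {linear B -> ext_alg e} := T \- (ext_in e \o E).
  have gK : cancel g (ext_out e).
    by move=> i; rewrite /= linearB sec_funK ext_out_in subr0.
  exists (ExtSection gK); apply: (belongs_shift s tT _).2 st => i /=.
  by rewrite subrK.
pose g : {linear B -> ext_alg e} := T \- T'.
have [i|E gE] := @ext_ker_lift _ g; first by rewrite /= linearB !sec_funK subrr.
by exists E; apply: (belongs_shift s tT _).1 sT' => i; rewrite gE /= addrC subrK.
Qed.

End Coordinates.

Section Comparison.
Variables (F : fieldType) (A B : nalgType F).
Implicit Types (e : extension A B) (s : factor_system A B).

Lemma belongs_transport e1 e2 s (T1 : ext_section e1) :
  belongs s T1 -> extension_equiv e1 e2 ->
  exists T2 : ext_section e2, belongs s T2.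
Proof.
move=> /belongsP[sl sr sf] [tau [tauM _ tau_in tau_out]].
pose g : {linear B -> ext_alg e2} := tau \o T1.
have gK : cancel g (ext_out e2).
  by move=> i; have /= -> := tau_out (T1 i); rewrite sec_funK.
exists (ExtSection gK); apply/belongsP.
have inE a : ext_in e2 a = tau (ext_in e1 a) by rewrite -tau_in.
by split=> i m /=; rewrite !inE ?(sl, sr, sf) ?linearB !tauM.
Qed.

Lemma section_match e1 e2 (T1 : ext_section e1) (T2 : ext_section e2) :
  exists tau : {linear ext_alg e1 -> ext_alg e2},
    forall a i, tau (ext_in e1 a + T1 i) = ext_in e2 a + T2 i.
Proof.
have [r rE] := section_coord T1.
pose tau : {linear ext_alg e1 -> ext_alg e2} :=
  (ext_in e2 \o r) \+ (T2 \o ext_out e1).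
exists tau => a i /=.
by have [<- <-] := section_coord_inj (rE (ext_in e1 a + T1 i)).
Qed.

(** Matching coordinates respects products since both products are given by
    the same formula [belongs_mul]; exchanging the two extensions gives the
    inverse map. *)
Lemma belongs_common_equiv e1 e2 s (T1 : ext_section e1) (T2 : ext_section e2) :
  belongs s T1 -> belongs s T2 -> extension_equiv e1 e2.
Proof.
move=> sT1 sT2.
have [tau tauE] := section_match T1 T2; have [rho rhoE] := section_match T2 T1.
have [r1 r1E] := section_coord T1; have [r2 r2E] := section_coord T2.
exists tau; split.
- move=> x y; rewrite (r1E x) (r1E y).
  by rewrite (belongs_mul sT1) !tauE (belongs_mul sT2).
- by exists rho => x; [rewrite (r1E x) tauE rhoE | rewrite (r2E x) rhoE tauE].
- by move=> a; have := tauE a 0; rewrite !linear0 !addr0.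
- move=> x /=; rewrite (r1E x) tauE.
  by rewrite !linearD !ext_out_in !sec_funK.
Qed.

End Comparison.

Theorem theorem3p3 (F : fieldType) (A B : leibnizType F)
    (e1 : extension A B) (T1 : ext_section e1) (s1 : factor_system A B)
    (e2 : extension A B) (T2 : ext_section e2) (s2 : factor_system A B)
    (h1 : belongs s1 T1) (h2 : belongs s2 T2) :
  factor_system_equiv s1 s2 <-> extension_equiv e1 e2.
Proof.
apply: (iff_trans (belongs_shift_equiv s1 h2)); split=> [[T] | ].
  exact: belongs_common_equiv h1.
exact: belongs_transport h1.
Qed.
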